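(* Let $k$ and $n$ be integers with $k\geq 3$ and $n\geq k+2$. If $G$ is a connected $k$-regular graph of order $n$, then $$C(G)\leq 1-\frac{6}{k(k+1)},$$ with equality if and only if $n/(k+1)$ is an integer and $G$ is isomorphic to $G(k,n/(k+1))$.
   Context: All graphs are finite and simple. For a vertex $u$ of a graph $G$, $N_G(u)$ is its neighborhood, $d_G(u)$ its degree, and $m(G[N_G(u)])$ the number of edges of the subgraph induced by $N_G(u)$. The clustering coefficient of $u$ in $G$ is $C_u(G)=m(G[N_G(u)])/\binom{d_G(u)}{2}$ if $d_G(u)\geq 2$, and $C_u(G)=0$ otherwise. The clustering coefficient of $G$ is $C(G)=\frac{1}{n(G)}\sum_{u\in V(G)}C_u(G)$, where $n(G)$ is the order of $G$. For integers $k\geq 3$ and $\ell\geq 2$, $G(k,\ell)$ denotes the $k$-regular connected graph obtained from $\ell$ disjoint copies $G_1,\ldots,G_\ell$ of $K_{k+1}-e$ (the complete graph on $k+1$ vertices minus one edge) by adding, for every $i\in\{1,\ldots,\ell\}$, an edge between a vertex of $G_i$ and a vertex of $G_{i+1}$ (indices modulo $\ell$), chosen so that the resulting graph is $k$-regular; i.e., each of the two vertices of degree $k-1$ in each $G_i$ receives exactly one new edge, one going to $G_{i-1}$ and one to $G_{i+1}$. This graph is unique up to isomorphism. *)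

(* Defs.v *)
From HB Require Import structures.
From mathcomp Require Import all_boot all_order all_algebra.
Set Implicit Arguments. Unset Strict Implicit. Unset Printing Implicit Defensive.
Import Order.TTheory GRing.Theory Num.Theory.

(* A finite simple graph is a symmetric irreflexive relation e : rel T
   on a finite type T (the vertex set). *)
Section Graph.
Variables (T : finType) (e : rel T).

Definition nbhd (u : T) : {set T} := [set v | e u v].
Definition deg (u : T) : nat := #|nbhd u|.
Definition is_edge (A : {set T}) : bool :=
  [exists x, exists y, e x y && (A == [set x; y])].
Definition induced_edges (S : {set T}) : nat :=
  #|[set A : {set T} | (A \subset S) && is_edge A]|.
Definition clust_vertex (u : T) : rat :=
  if 2 <= deg u then
    ((induced_edges (nbhd u))%:R / ('C(deg u, 2))%:R)%R
  else 0%R.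
End Graph.

Definition clustering (T : finType) (e : rel T) : rat :=
  ((\sum_(u : T) clust_vertex e u) / (#|T|)%:R)%R.

Definition regular (T : finType) (e : rel T) (k : nat) : Prop :=
  forall u : T, deg e u = k.

Definition connected (T : finType) (e : rel T) : Prop :=
  forall x y : T, connect e x y.

Definition isomorphic (T1 T2 : finType) (e1 : rel T1) (e2 : rel T2) : Prop :=
  exists f : T1 -> T2, bijective f /\ forall x y, e2 (f x) (f y) = e1 x y.

(* G(k,l): vertex (i,j) is vertex j of copy G_i (copy i is K_{k+1} minus
   the edge {0,1}); vertex (i,1) is joined to vertex (i+1 mod l, 0). *)
Definition Gkl_vertex (k l : nat) : finType := ('I_l * 'I_k.+1)%type.

Definition Gkl_rel (k l : nat) : rel (Gkl_vertex k l) :=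
  fun x y =>
    let: (i, j) := x in let: (i', j') := y in
    [|| (i == i') && (j != j') &&
          ~~ (((val j == 0) && (val j' == 1)) || ((val j == 1) && (val j' == 0))),
        (val j == 1) && (val j' == 0) && (val i' == (val i).+1 %% l)
      | (val j == 0) && (val j' == 1) && (val i == (val i').+1 %% l)].

(* Main.v *)
Require Import Defs.
From HB Require Import structures.
From mathcomp Require Import all_boot all_order all_algebra.
From mathcomp Require Import zify ring.
Set Implicit Arguments. Unset Strict Implicit. Unset Printing Implicit Defensive.
Import Order.TTheory GRing.Theory Num.Theory.

(** Let d(v) be the number of edges missing in G[N(v)]. By regularity, summing d
    over the closed neighbourhood N[u] and then over u gives (k+1) times the total,
    so it suffices to show that d sums to at least 3(k-1) over each N[u]. Let H be
    the complement of G[N(u)], with d = d(u) >= 1 edges (connectivity) and m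
    isolated vertices. Classifying the nonadjacent pairs in N(v), v in N(u), by
    their position relative to u yields
      sum over N[u] >= 3d + 2md + d max(m, 2(k-1-d) - m) >= 3(k-1),
    and equality forces d = 1 or d = k-1. If equality holds for all u, each N[u]
    contains exactly two vertices with d = k-1, the closed neighbourhoods of the
    vertices with d = 1 are disjoint copies of K_{k+1} - e covering G, and by
    connectivity these copies are arranged in a single ring. *)

(** * Lower bound for the total defect of a closed neighbourhood *)

Section LocalBound.
Variables (T : finType) (e : rel T) (k : nat).
Hypotheses (e_sym : symmetric e) (e_irr : irreflexive e) (e_reg : regular e k).

Local Notation N := (nbhd e).

Definition nonadj (x y : T) : bool := (x != y) && ~~ e x y.

(* Ordered pairs: the defect is twice the number of edges missing in G[N(v)]. *)
Definition defect (v : T) : nat := \sum_(x in N v) \sum_(y in N v) nonadj x y.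

Definition codeg (u v : T) : nat := \sum_(x in N u) nonadj v x.

(* The vertices of N(u) that are closed twins of u. *)
Definition dominating (u : T) : {set T} := [set x in N u | codeg u x == 0].

Lemma in_nbhd u v : (v \in N u) = e u v.
Proof. by rewrite inE. Qed.

Lemma nonadj_sym x y : nonadj x y = nonadj y x.
Proof. by rewrite /nonadj eq_sym e_sym. Qed.

Lemma nonadjxx x : nonadj x x = false.
Proof. by rewrite /nonadj eqxx. Qed.

Lemma card_nbhd u : #|N u| = k.
Proof. exact: e_reg. Qed.

(** The k vertices of N(u) are v itself, the non-neighbours of v and the common neighbours of u and
    v. *)
Lemma codeg_common u v : e u v ->
  codeg u v + 1 + \sum_(x in N u) e v x = k.
Proof.
move=> euv; rewrite -(card_nbhd u) -sum1_card.
have E1 : \sum_(x in N u) (x == v) = 1.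
  rewrite (bigD1 v) ?in_nbhd //= eqxx big1 ?addn0 // => x /andP[_ /negbTE ->] //.
rewrite -{1}E1 /codeg -!big_split /=; apply: eq_bigr => x _.
by rewrite /nonadj eq_sym; case: eqP => [->|_]; rewrite ?e_irr //=; case: (e v x).
Qed.

Lemma codegC u v : e u v -> codeg u v = codeg v u.
Proof.
move=> euv; have evu : e v u by rewrite e_sym.
have := codeg_common euv; have := codeg_common evu.
have -> : \sum_(x in N u) e v x = \sum_(x in N v) e u x.
  rewrite [LHS]big_mkcond [RHS]big_mkcond; apply: eq_bigr => x _.
  by rewrite !in_nbhd; case: (e u x); case: (e v x).
lia.
Qed.

Lemma defectE u : defect u = \sum_(v in N u) codeg u v.
Proof. by []. Qed.

Lemma dominating_adj u x y :
  x \in dominating u -> e u y -> x != y -> e x y.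
Proof.
rewrite inE => /andP[_ /eqP h0] euy xy.
apply/negPn/negP => nxy; move: h0; rewrite /codeg (bigD1 y) ?in_nbhd //=.
by rewrite /nonadj xy nxy.
Qed.

(** The symmetry [codegC] turns [codeg u x = 0] into [codeg x u = 0]: every neighbour of x other
    than u is a neighbour of u. *)
Lemma dominating_nonadj u x z :
  x \in dominating u -> nonadj u z -> nonadj x z.
Proof.
move=> xM /andP[uz nuz]; have := xM; rewrite inE in_nbhd => /andP[eux /eqP h0].
have := codegC eux; rewrite h0 => /esym h0'.
rewrite /nonadj; apply/andP; split; first by apply: contraNneq nuz => <-.
apply/negP => exz; move: h0'; rewrite /codeg (bigD1 z) ?in_nbhd //=.
by rewrite /nonadj uz nuz.
Qed.

Definition nonadj_pairs (u : T) : {set T * T} :=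
  [set p | [&& p.1 \in N u, p.2 \in N u & nonadj p.1 p.2]].

Lemma defect_pairs u : defect u = #|nonadj_pairs u|.
Proof.
rewrite /defect pair_big /= -sum1_card big_mkcond [RHS]big_mkcond.
apply: eq_bigr => p _; rewrite [in RHS]inE.
by case: (p.1 \in N u); case: (p.2 \in N u); case: (nonadj _ _).
Qed.

Lemma defect_le2 u p q :
  (forall x y, e u x -> e u y -> nonadj x y -> x = p /\ y = q \/ x = q /\ y = p) ->
  defect u <= 2.
Proof.
move=> H; rewrite defect_pairs.
apply: (@leq_trans #|[set (p, q); (q, p)]|); last by rewrite cards2; case: eqP.
apply/subset_leq_card/subsetP => -[x y]; rewrite !inE /= !xpair_eqE => /and3P[eux euy nxy].
by case: (H x y) => // -[-> ->]; rewrite !eqxx ?orbT.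
Qed.

Lemma defect_le_star u z : e u z ->
  (forall x y, e u x -> e u y -> nonadj x y -> x = z \/ y = z) ->
  defect u <= 2 * k.-1.
Proof.
move=> euz H; rewrite defect_pairs.
set A := N u :\ z.
have cA : #|A| = k.-1 by rewrite -(card_nbhd u) (cardsD1 z (N u)) in_nbhd euz.
apply: (@leq_trans #|setX [set z] A :|: setX A [set z]|); last first.
  by rewrite (leq_trans (leq_card_setU _ _)) // !cardsX cards1 cA; lia.
apply/subset_leq_card/subsetP => -[x y]; rewrite !inE /= => /and3P[eux euy nxy].
have xy : x != y by case/andP: nxy.
rewrite eux euy !andbT.
case: (H x y) => // E; rewrite E eqxx; first by rewrite -E eq_sym xy.
by rewrite -E xy orbT.
Qed.

Lemma nonadj_codeg_gt0 u x y : e u y -> nonadj x y -> 0 < codeg u x.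
Proof. by move=> euy nxy; rewrite /codeg (bigD1 y) ?in_nbhd //= nxy. Qed.

(* The nonadjacent pairs in N(v) are sorted by which of their members are u,
   neighbours of u, or non-neighbours of u. *)
Lemma defect_nbr_ge u v : e u v ->
  2 * codeg u v + 2 * (#|dominating u| * codeg u v)
  + \sum_(x in N u) \sum_(y in N u) (nonadj x y && (e v x && e v y))
  <= defect v.
Proof.
move=> euv; have evu : e v u by rewrite e_sym.
set M := dominating u.
have E1 : codeg u v = \sum_(x in N v) \sum_(y in N v) ((x == u) && nonadj u y).
  rewrite codegC // (bigD1 u) ?in_nbhd //= [X in _ + X]big1 ?addn0.
    by apply: eq_bigr => y _; rewrite eqxx.
  by move=> x /andP[_ /negbTE ->]; rewrite big1.
have E2 : codeg u v = \sum_(x in N v) \sum_(y in N v) ((y == u) && nonadj u x).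
  by rewrite E1 exchange_big.
have E3 : #|M| * codeg u v
    <= \sum_(x in N v) \sum_(y in N v) ((x \in M) && nonadj u y).
  have [h0|h0] := posnP (codeg u v); first by rewrite h0 muln0.
  (* Hence every vertex of [M] differs from v and is adjacent to it, so [M] lies inside N(v). *)
  have vM : v \notin M by rewrite inE negb_and -lt0n h0 orbT.
  rewrite -sum1_card big_distrl /= [X in _ <= X]big_mkcond /= big_mkcond /=.
  apply: leq_sum => x _; case: ifP => // xM.
  have exv : e x v by apply: (dominating_adj xM) => //; apply: contraNneq vM => <-.
  by rewrite in_nbhd e_sym exv mul1n codegC.
have E4 : #|M| * codeg u v
    <= \sum_(x in N v) \sum_(y in N v) ((y \in M) && nonadj u x).
  by rewrite exchange_big.
have E5 : \sum_(x in N u) \sum_(y in N u) (nonadj x y && (e v x && e v y))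
   = \sum_(x in N v) \sum_(y in N v) (nonadj x y && (e u x && e u y)).
  rewrite [LHS]big_mkcond [RHS]big_mkcond; apply: eq_bigr => x _ /=.
  rewrite !in_nbhd.
  have [eux|_] /= := boolP (e u x); have [evx|_] //= := boolP (e v x).
  - rewrite [LHS]big_mkcond [RHS]big_mkcond; apply: eq_bigr => y _ /=.
    by rewrite !in_nbhd; case: (e u y); case: (e v y); rewrite ?andbF.
  - by rewrite big1 // => y _; rewrite andbF.
  - by rewrite big1 // => y _; rewrite andbF.
rewrite E5 /defect.
(* The five indicators exclude one another, and each of them implies [nonadj x y]; so their sum is
   at most [nonadj x y] for every pair. *)
apply: (@leq_trans (\sum_(x in N v) \sum_(y in N v)
  (((x == u) && nonadj u y) + ((y == u) && nonadj u x) +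
   ((x \in M) && nonadj u y) + ((y \in M) && nonadj u x) +
   (nonadj x y && (e u x && e u y))))).
  under [X in _ <= X]eq_bigr do rewrite !big_split /=.
  rewrite !big_split /= -E1 -E2; lia.
apply: leq_sum => x; rewrite in_nbhd => evx.
apply: leq_sum => y; rewrite in_nbhd => evy.
have Mu z : z \in M -> e u z by rewrite inE in_nbhd => /andP[].
have [->|xu] := eqVneq x u.
  have -> : (u \in M) = false by apply/negP => /Mu; rewrite e_irr.
  rewrite nonadjxx e_irr /= !andbF.
  by case: (nonadj u y).
have [->|yu] /= := eqVneq y u.
  have -> : (u \in M) = false by apply/negP => /Mu; rewrite e_irr.
  rewrite nonadjxx e_irr /= !andbF nonadj_sym.
  by case: (nonadj x u).
have [nuy|] /= := boolP (nonadj u y).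
  have -> : e u y = false by case/andP: nuy => _ /negbTE.
  have -> : (y \in M) = false.
    by apply/negP => /Mu euy; case/andP: nuy => _; rewrite euy.
  rewrite !andbF /= !andbT.
  have [xM|//] := boolP (x \in M).
  by rewrite (dominating_nonadj xM nuy).
rewrite !andbF /= => nuy.
have [nux|] /= := boolP (nonadj u x).
  have -> : e u x = false by case/andP: nux => _ /negbTE.
  rewrite !andbF /= !andbT.
  have [yM|//] := boolP (y \in M).
  by rewrite nonadj_sym (dominating_nonadj yM nux).
by rewrite !andbF; case: (nonadj x y); case: (e u x && e u y).
Qed.

(** For a pair missing in G[N(u)], this counts the v in N(u) for which the same pair is missing in
    G[N(v)]. *)
Definition common_nbrs (u x y : T) : nat := \sum_(v in N u) (e v x && e v y).

(** A closed twin of u is adjacent to every other vertex of N(u), and neither x nor y is such a twin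
    because their codegrees are positive. *)
Lemma common_nbrs_ge_dominating u x y : e u x -> e u y -> nonadj x y ->
  #|dominating u| <= common_nbrs u x y.
Proof.
move=> eux euy nxy; rewrite /common_nbrs -sum1_card big_mkcond /= [X in _ <= X]big_mkcond /=.
apply: leq_sum => v _; case: ifP => // vM.
have := vM; rewrite inE => /andP[-> /eqP h0].
have nz z t : e u t -> nonadj z t -> v != z.
  by move=> eut nzt; apply: contraTneq (nonadj_codeg_gt0 eut nzt) => <-; rewrite h0.
rewrite (dominating_adj vM eux) ?(dominating_adj vM euy) //.
  by apply: nz eux _; rewrite nonadj_sym.
exact: nz euy nxy.
Qed.

Lemma common_nbrs_ge u x y : e u x -> e u y -> nonadj x y ->
  2 * k <= common_nbrs u x y + #|dominating u| + defect u + 2.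
Proof.
move=> eux euy nxy.
(* A vertex of N(u) is a common neighbour of x and y or is nonadjacent to one of them; x and y are
   themselves covered by [nonadj x y]. *)
have H1 : k <= common_nbrs u x y + codeg u x + codeg u y.
  rewrite -{1}(card_nbhd u) -sum1_card /common_nbrs /codeg -!big_split /=.
  apply: leq_sum => v _.
  have [->|vx] := eqVneq v x; first by rewrite (nonadj_sym y x) nxy /=; lia.
  have [->|vy] := eqVneq v y; first by rewrite nxy /=; lia.
  rewrite /nonadj eq_sym vx (eq_sym y v) vy (e_sym x v) (e_sym y v) /=.
  by case: (e v x); case: (e v y).
have xy : x != y by case/andP: nxy.
have S1 z (F : T -> nat) : e u z -> \sum_(v in N u) (v == z) * F v = F z.
  move=> euz; rewrite (bigD1 z) ?in_nbhd //= eqxx big1 ?addn0 ?mul1n //.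
  by move=> v /andP[_ /negbTE ->].
have SM : #|dominating u| = \sum_(v in N u) (v \in dominating u).
  rewrite -sum1_card big_mkcond /= [RHS]big_mkcond /=; apply: eq_bigr => v _.
  by rewrite inE; case: (v \in N u) => //=; case: eqP.
(* The defect is the degree sum of the complement of G[N(u)]: besides x and y, each vertex that is
   not dominating contributes at least 1. The two units on the right pay for x and y. *)
have H2 : codeg u x + codeg u y + k <= defect u + #|dominating u| + 1 + 1.
  have : \sum_(v in N u) ((v == x) * codeg u v + (v == y) * codeg u v + 1) <=
      \sum_(v in N u) (codeg u v + (v \in dominating u) + (v == x) * 1 + (v == y) * 1).
    apply: leq_sum => v vN.
    have gx : 0 < codeg u x by apply: nonadj_codeg_gt0 euy _.
    have gy : 0 < codeg u y by apply: (nonadj_codeg_gt0 eux); rewrite nonadj_sym.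
    have [->|vx] := eqVneq v x; first by rewrite (negbTE xy) /=; lia.
    have [->|vy] := eqVneq v y; first by rewrite /=; lia.
    by rewrite inE vN /=; case: (codeg u v) => //=; lia.
  rewrite !big_split /= !(S1 _ (codeg u)) // !(S1 _ (fun=> 1)) //.
  by rewrite sum1_card card_nbhd -SM -defectE.
lia.
Qed.

(** Sum [defect_nbr_ge] over v in N(u). In the triple sum each missing pair is counted [common_nbrs]
    times, which is at least the maximum by the two preceding bounds. *)
Lemma defect_nbrs_ge u :
  (3 + 2 * #|dominating u|
   + maxn #|dominating u| (2 * k - 2 - #|dominating u| - defect u)) * defect u
  <= defect u + \sum_(v in N u) defect v.
Proof.
set m := #|dominating u|; set w := maxn _ _.
have H : \sum_(v in N u) (2 * codeg u v + 2 * (m * codeg u v)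
  + \sum_(x in N u) \sum_(y in N u) (nonadj x y && (e v x && e v y)))
  <= \sum_(v in N u) defect v.
  by apply: leq_sum => v; rewrite in_nbhd => /defect_nbr_ge.
move: H; rewrite !big_split /= -!big_distrr /= -defectE.
suff : w * defect u <= \sum_(v in N u)
  \sum_(x in N u) \sum_(y in N u) (nonadj x y && (e v x && e v y)) by nia.
rewrite exchange_big /= /defect big_distrr /=; apply: leq_sum => x.
rewrite in_nbhd => eux; rewrite exchange_big big_distrr /=.
apply: leq_sum => y; rewrite in_nbhd => euy.
have [nxy|_] := boolP (nonadj x y); last by rewrite muln0.
rewrite muln1 -/(common_nbrs u x y) geq_max common_nbrs_ge_dominating //=.
by have := common_nbrs_ge eux euy nxy; rewrite -/m; lia.
Qed.

Lemma dominating_card_le u : 0 < defect u -> #|dominating u| + 2 <= k.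
Proof.
move=> D0.
have /existsP[x /existsP[y /and3P[eux euy nxy]]] :
    [exists x, exists y, [&& e u x, e u y & nonadj x y]].
  apply: contraTT D0 => /existsPn H; rewrite -eqn0Ngt /defect big1 // => x.
  rewrite in_nbhd => eux; rewrite big1 // => y; rewrite in_nbhd => euy.
  by move/existsPn/(_ y): (H x); rewrite eux euy /= => /negbTE ->.
have xy : x != y by case/andP: nxy.
have := cardsU1 x [set y]; rewrite cards1 inE xy /= => c2.
rewrite -(card_nbhd u) -(cardsID (dominating u) (N u)).
apply: leq_add.
  by apply/subset_leq_card/subsetP => v vM; have := vM; rewrite !inE => /andP[-> ->].
rewrite -[2]c2; apply/subset_leq_card/subsetP => v; rewrite !inE.
case/orP => /eqP ->; rewrite ?eux ?euy /= andbT -lt0n.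
  exact: nonadj_codeg_gt0 euy nxy.
by apply: nonadj_codeg_gt0 eux _; rewrite nonadj_sym.
Qed.

(** Each vertex of N(u) that is not dominating contributes at least 1 to the defect. *)
Lemma dominating_card_ge u : k <= defect u + #|dominating u|.
Proof.
rewrite -{1}(card_nbhd u) -(cardsID (dominating u) (N u)) addnC.
apply: leq_add; last by apply/subset_leq_card/subsetIr.
rewrite -sum1_card defectE big_mkcond /= [X in _ <= X]big_mkcond /=.
apply: leq_sum => v _; rewrite !inE; case: (e u v); rewrite ?andbF //=.
by case: (codeg u v).
Qed.

Lemma induced_edgesE (A : {set T}) :
  2 * induced_edges e A = \sum_(x in A) \sum_(y in A) e x y.
Proof.
rewrite pair_big /= big_mkcond /= /induced_edges.
set P := [set B : {set T} | _].
pose E := [set p : T * T | [&& p.1 \in A, p.2 \in A & e p.1 p.2]].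
have -> : \sum_p (if (p.1 \in A) && (p.2 \in A) then nat_of_bool (e p.1 p.2) else 0)
    = \sum_(p in E) 1.
  rewrite [RHS]big_mkcond; apply: eq_bigr => p _; rewrite inE.
  by case: (p.1 \in A); case: (p.2 \in A); case: (e _ _).
rewrite (partition_big (fun p => [set p.1; p.2]) (mem P)) /=; last first.
  move=> [x y]; rewrite !inE /= => /and3P[xA yA exy].
  apply/andP; split; first by apply/subsetP => z; rewrite !inE => /orP[]/eqP->.
  by apply/existsP; exists x; apply/existsP; exists y; rewrite exy /=.
rewrite mulnC -sum1_card big_distrl /=; apply: eq_bigr => B.
rewrite inE => /andP[BA /existsP[x /existsP[y /andP[exy /eqP BE]]]].
rewrite sum1_card mul1n.
have xy : x != y by apply: contraTneq exy => ->; rewrite e_irr.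
have xA : x \in A by apply: (subsetP BA); rewrite BE !inE eqxx.
have yA : y \in A by apply: (subsetP BA); rewrite BE !inE eqxx orbT.
(* The fibre over an edge consists of its two orientations. *)
have <- : #|[set (x, y); (y, x)]| = 2 by rewrite cards2 xpair_eqE (negbTE xy).
apply: eq_card => -[a b]; rewrite !inE unfold_in inE /= !xpair_eqE.
apply/idP/idP.
  case/orP=> /andP[/eqP -> /eqP ->]; rewrite xA yA ?(e_sym y) exy BE ?eqxx //=.
  by rewrite setUC eqxx.
case/andP=> /and3P[aA bA eab] /eqP E2.
have ab : a != b by apply: contraTneq eab => ->; rewrite e_irr.
have : a \in [set x; y] by rewrite -BE -E2 !inE eqxx.
have : b \in [set x; y] by rewrite -BE -E2 !inE eqxx orbT.
rewrite !inE => /orP[]/eqP bE /orP[]/eqP aE; move: ab; rewrite aE bE ?eqxx //= ?orbT //.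
Qed.

Lemma induced_edges_defect u :
  induced_edges e (N u) * 2 + defect u = k * k.-1.
Proof.
rewrite mulnC induced_edgesE /defect -big_split /=.
rewrite -{1}(card_nbhd u) -sum1_card big_distrl /=; apply: eq_bigr => x xN.
rewrite mul1n -big_split /= -(card_nbhd u) (cardsD1 x) xN /= -sum1_card.
rewrite (bigD1 x) //= e_irr nonadjxx add0n.
apply: eq_big => y; first by rewrite !inE andbC.
by case/andP=> _ yx; rewrite /nonadj eq_sym yx /=; case: (e x y).
Qed.

Lemma defect_half u : 
  exists2 d, defect u = 2 * d & induced_edges e (N u) + d = 'C(k, 2).
Proof.
have := induced_edges_defect u; have := bin2 k; rewrite -divn2.
have := odd_double_half (k * k.-1).
have -> : odd (k * k.-1) = false by case: (k) => //= n; rewrite oddM /= andNb.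
rewrite -divn2 => h1 h2 h3.
exists ('C(k,2) - induced_edges e (N u)); lia.
Qed.

Lemma defect_closed_nbhd u : 0 < defect u ->
  6 * k.-1 <= defect u + \sum_(v in N u) defect v /\
  (defect u + \sum_(v in N u) defect v = 6 * k.-1 ->
    defect u = 2 \/ defect u = 2 * k.-1).
Proof.
move=> D0; have := dominating_card_ge u; have := defect_nbrs_ge u; have := dominating_card_le D0.
have [d dE _] := defect_half u; rewrite dE in D0 *.
set m := #|_|; set S := 2 * d + _; move=> mk.
have [j kE] : exists j, k = m + j + 2 by exists (k - m - 2); lia.
have d0 : 0 < d by lia.
(* The threshold is where the two arguments of the maximum coincide; [kE] writes k - 1 - m as j +
   1. *)
have [q0|q0] := leqP (k - 1 - m) d; rewrite kE in q0 *.
  have -> : maxn m (2 * (m + j + 2) - 2 - m - 2 * d) = m by lia.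
  have [t ->] : exists t, d = j + 1 + t by exists (d - j - 1); lia.
  move=> H _; have {}H : 6 * (m + j + 1) + 6 * (m * j) + 6 * t + 6 * (m * t) <= S.
    by apply: leq_trans H; nia.
  split; first by nia.
  (* The excess over 6(k-1) is at least 6(mj + t + mt). If it vanishes, then t = 0, and m = 0 gives
     d = k-1 while j = 0 gives d = 1. *)
  move=> SE; have : m * j = 0 by nia.
  have : t = 0 by nia.
  move=> -> /eqP; rewrite muln_eq0 => /orP[]/eqP->; [right|left]; lia.
have -> : maxn m (2 * (m + j + 2) - 2 - m - 2 * d) = m + 2 * (j + 1 - d) by lia.
have [q [q1 ->]] : exists q, 0 < q /\ j = q + d - 1 by exists (j + 1 - d); lia.
have [t ->] : exists t, d = t + 1 by exists (d - 1); lia.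
move=> H mD.
have {}H : 6 * m + 6 * (t * m) + 6 + 6 * t + 4 * (t * q) + 4 * q <= S.
  by apply: leq_trans H; nia.
(* The inequality [mD] amounts to q <= t. The excess over 6(k-1) is then at least 4tq - 2q >= 2q >
   0, so equality is impossible in this case. *)
have t1 : 0 < t by lia.
have : q <= t * q by rewrite leq_pmull.
by split; lia.
Qed.
End LocalBound.

(** Meant for a two-element set containing x; the default x is returned only when nothing else is in
    [A]. *)
Definition other (T : finType) (A : {set T}) (x : T) : T :=
  odflt x [pick y in A :\ x].

Lemma otherP (T : finType) (A : {set T}) (x : T) :
  #|A| = 2 -> x \in A -> other A x != x /\ A = [set x; other A x].
Proof.
move=> A2 xA; have : #|A :\ x| == 1 by rewrite -eqSS -A2 (cardsD1 x A) xA.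
case/cards1P => z Az; rewrite /other.
case: pickP => [y|/(_ z)]; last by rewrite Az inE eqxx.
rewrite Az inE => /eqP ->.
have : z \in A :\ x by rewrite Az inE.
rewrite !inE => /andP[-> _]; split=> //.
by rewrite -(setD1K xA) Az.
Qed.

(** * Averaging the local bound over a connected graph *)

Section Connected.
Variables (T : finType) (e : rel T) (k : nat).
Hypotheses (e_sym : symmetric e) (e_irr : irreflexive e) (e_reg : regular e k).
Hypotheses (e_conn : connected e).

Local Notation N := (nbhd e).
Local Notation D := (defect e).

Lemma connected_ind (P : T -> Prop) x0 :
  (forall x y, e x y -> P x -> P y) -> P x0 -> forall y, P y.
Proof.
move=> Pe Px0 y; have /connectP[p] := e_conn x0 y.
elim: p x0 Px0 => [|z p IHp] x Px /=; first by move=> _ ->.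
by case/andP=> /Pe/(_ Px); apply: IHp.
Qed.

(** If no edge were missing in G[N(u)], all neighbours of u would be closed twins of u, so the
    closed neighbourhood of u would be a connected component with only k+1 vertices. *)
Lemma defect_gt0 u : k.+1 < #|T| -> 0 < D u.
Proof.
move=> kT; rewrite lt0n; apply/eqP => D0.
suff H : forall y, y \in u |: N u.
  have : #|T| <= #|u |: N u| by apply/subset_leq_card/subsetP => y _; apply: H.
  by rewrite cardsU1 in_nbhd e_irr /= (card_nbhd e_reg) add1n leqNgt kT.
apply: (@connected_ind _ u); last by rewrite !inE eqxx.
move=> x y exy; rewrite in_setU1 => /orP[/eqP xu|xN].
  by rewrite !inE -xu exy orbT.
have xM : x \in dominating e u.
  by rewrite inE xN -leqn0 -D0 defectE (bigD1 x xN) leq_addr.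
apply/negPn/negP; rewrite !inE negb_or => /andP[yu nuy].
have nuy' : nonadj e u y by rewrite /nonadj eq_sym yu nuy.
by have := dominating_nonadj e_sym e_irr e_reg xM nuy'; rewrite /nonadj exy andbF.
Qed.

(** Each vertex lies in exactly k+1 closed neighbourhoods. *)
Lemma sum_closed_nbhd (F : T -> nat) :
  \sum_u (F u + \sum_(v in N u) F v) = k.+1 * \sum_u F u.
Proof.
rewrite big_split /= mulSn; congr (_ + _).
rewrite (exchange_big_dep predT) //= big_distrr /=; apply: eq_bigr => v _.
rewrite sum_nat_const; congr (_ * _); rewrite -(card_nbhd e_reg v).
by apply: eq_card => u; rewrite in_nbhd e_sym; apply: in_nbhd.
Qed.

Lemma sum_defect_ge : k.+1 < #|T| -> 6 * k.-1 * #|T| <= k.+1 * \sum_u D u.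
Proof.
move=> kT; rewrite -sum_closed_nbhd mulnC -sum_nat_const; apply: leq_sum => u _.
by have [] := defect_closed_nbhd e_sym e_irr e_reg (defect_gt0 u kT).
Qed.

Lemma sum_defect_eq u : k.+1 < #|T| -> k.+1 * \sum_u D u = 6 * k.-1 * #|T| ->
  D u + \sum_(v in N u) D v = 6 * k.-1.
Proof.
move=> kT; rewrite -sum_closed_nbhd mulnC -sum_nat_const.
have ge v : 6 * k.-1 <= D v + \sum_(w in N v) D w.
  by have [] := defect_closed_nbhd e_sym e_irr e_reg (defect_gt0 v kT).
rewrite (bigD1 u) // [RHS](bigD1 u) //= => E.
have : \sum_(i | i != u) 6 * k.-1
   <= \sum_(i | i != u) (D i + \sum_(v in N i) D v) by apply: leq_sum.
have := ge u; lia.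
Qed.

End Connected.

(** * Structure of the graphs attaining equality *)

Section Extremal.
Variables (T : finType) (e : rel T) (k : nat).
Hypotheses (e_sym : symmetric e) (e_irr : irreflexive e) (e_reg : regular e k).
Hypotheses (e_conn : connected e) (k_ge3 : 3 <= k) (kT : k.+1 < #|T|).
Hypothesis sum_eq : k.+1 * \sum_u defect e u = 6 * k.-1 * #|T|.

Local Notation N := (nbhd e).
Local Notation D := (defect e).
Local Notation CN u := (u |: nbhd e u).

(* Every vertex now has defect 2 or 2(k-1); the large ones are the two
   nonadjacent vertices of the copies of K_{k+1} - e. *)
Definition large (v : T) : bool := D v == 2 * k.-1.

Definition large_in (A : {set T}) : {set T} := [set v in A | large v].
Definition small_in (A : {set T}) : {set T} := [set v in A | ~~ large v].

Lemma in_large_in A x : (x \in large_in A) = (x \in A) && large x.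
Proof. by rewrite inE. Qed.

Lemma in_small_in A x : (x \in small_in A) = (x \in A) && ~~ large x.
Proof. by rewrite inE. Qed.

Lemma defect_small v : ~~ large v -> D v = 2.
Proof.
rewrite /large => /eqP nl.
have [_ H] := defect_closed_nbhd e_sym e_irr e_reg (defect_gt0 e_sym e_irr e_reg e_conn v kT).
by case: (H (sum_defect_eq e_sym e_irr e_reg e_conn v kT sum_eq)).
Qed.

Lemma in_CN u v : (v \in CN u) = (v == u) || e u v.
Proof. by rewrite !inE. Qed.

Lemma CN_sym u v : (v \in CN u) = (u \in CN v).
Proof. by rewrite !in_CN eq_sym e_sym. Qed.

Lemma card_CN u : #|CN u| = k.+1.
Proof. by rewrite cardsU1 in_nbhd e_irr (card_nbhd e_reg). Qed.

(** With L large vertices the local equality reads 2(k+1) + L(2k-4) = 6(k-1), and k >= 3 allows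
    dividing by 2k-4. *)
Lemma card_large_CN u : #|large_in (CN u)| = 2.
Proof.
have := sum_defect_eq e_sym e_irr e_reg e_conn u kT sum_eq.
rewrite -big_setU1 ?in_nbhd ?e_irr //=.
have -> : \sum_(v in CN u) D v = \sum_(v in CN u) (2 + large v * (2 * k.-1 - 2)).
  apply: eq_bigr => v _; have [lv|/defect_small ->//] := boolP (large v).
  by rewrite (eqP lv); lia.
rewrite big_split /= sum_nat_const card_CN -big_distrl /=.
have -> : \sum_(v in CN u) large v = #|large_in (CN u)|.
  rewrite -sum1_card big_mkcond [RHS]big_mkcond; apply: eq_bigr => v _.
  by rewrite [in RHS]inE; case: (v \in CN u); case: (large v).
nia.
Qed.

Lemma card_small_CN u : #|small_in (CN u)| = k.-1.
Proof.
have := cardsID [set v | large v] (CN u).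
have -> : CN u :&: [set v | large v] = large_in (CN u).
  by apply/setP => v; rewrite !inE.
have -> : CN u :\: [set v | large v] = small_in (CN u).
  by apply/setP => v; rewrite !inE andbC.
rewrite card_large_CN card_CN; lia.
Qed.

(** Including u adds no nonadjacent pair. In this form the defect depends on the closed
    neighbourhood only, so closed twins have equal defects. *)
Lemma defect_CN u : D u = \sum_(x in CN u) \sum_(y in CN u) nonadj e x y.
Proof.
have uN : u \notin N u by rewrite in_nbhd e_irr.
have H x : x \in CN u -> nonadj e u x = false.
  by rewrite in_CN /nonadj eq_sym => /orP[->|->]//; rewrite andbF.
rewrite big_setU1 //= [X in _ = X + _]big1 ?add0n; last by move=> x /H ->.
apply: eq_bigr => x xN; rewrite big_setU1 //= nonadj_sym // H ?add0n //.
by rewrite in_setU1 xN orbT.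
Qed.

Lemma CN_twin u v : v \in N u -> v \in dominating e u -> CN v = CN u.
Proof.
move=> vN vM; apply/esym/eqP; rewrite eqEcard !card_CN leqnn andbT.
apply/subsetP => y; rewrite in_CN => /orP[/eqP->|euy].
  by rewrite CN_sym in_setU1 vN orbT.
by rewrite in_CN; have [//|yv] := eqVneq y v; rewrite (dominating_adj vM) // eq_sym.
Qed.

(** A defect of 2 means a single missing edge {a, b} in N(u). All other neighbours are closed twins
    of u, hence small, so a and b are the two large vertices of N[u], which thus induces K_{k+1} -
    e. *)
Lemma small_block u x y : ~~ large u -> x \in CN u -> y \in CN u -> x != y ->
  e x y = ~~ (large x && large y).
Proof.
move=> su; have Du := defect_small su.
have DP := defect_pairs e u; set P := nonadj_pairs e u in DP.
have [[a b]] : exists p, p \in P by apply/card_gt0P; rewrite -DP Du.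
rewrite inE /= => /and3P[aN bN nab].
have ab : a != b by case/andP: nab.
have PE : P = [set (a, b); (b, a)].
  apply/esym/eqP; rewrite eqEcard -DP Du cards2 xpair_eqE (negbTE ab) /= andbT.
  apply/subsetP => p; rewrite in_set2 => /orP[]/eqP ->; rewrite inE /= aN bN //=.
  by rewrite nonadj_sym.
have lE : large_in (CN u) = [set a; b].
  apply/eqP; rewrite eqEcard card_large_CN cards2 ab /= andbT.
  apply/subsetP => v; rewrite !inE => /andP[vCN lv].
  case/orP: vCN => [/eqP vu|euv]; first by rewrite vu (negbTE su) in lv.
  apply: contraLR lv; rewrite negb_or => /andP[va vb].
  have vN : v \in N u by rewrite in_nbhd.
  have vM : v \in dominating e u.
    rewrite inE vN /= /codeg big1 // => z zN.
    suff /negbTE -> : ~~ nonadj e v z by [].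
    apply/negP => nvz; have : (v, z) \in P by rewrite inE vN zN.
    by rewrite PE !inE !xpair_eqE (negbTE va) (negbTE vb).
  rewrite /large defect_CN (CN_twin vN vM) -defect_CN Du; lia.
move=> xC yC xy.
have lx z : z \in CN u -> large z = (z \in [set a; b]) by move=> zC; rewrite -lE [RHS]inE zC.
have uN v : v \in N u -> (u == v) = false.
  by move=> vN; apply: contraTF vN => /eqP <-; rewrite in_nbhd e_irr.
rewrite !lx // !inE.
have [xu|xu] := eqVneq x u.
  by rewrite -xu in_CN eq_sym (negbTE xy) /= in yC; rewrite yC xu !uN.
have [yu|yu] := eqVneq y u.
  by rewrite -yu in_CN (negbTE xy) /= e_sym in xC; rewrite xC yu !uN // andbF.
have {xC}xN : x \in N u by move: xC; rewrite in_setU1 (negbTE xu).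
have {yC}yN : y \in N u by move: yC; rewrite in_setU1 (negbTE yu).
have : ((x, y) \in P) = ~~ e x y by rewrite inE /= xN yN /nonadj xy.
rewrite PE !inE !xpair_eqE => /(congr1 negb); rewrite negbK => <-; congr (~~ _).
apply/idP/idP; first by case/orP=> /andP[-> ->]; rewrite ?orbT.
case/andP=> /orP[]/eqP xE /orP[]/eqP yE; move: xy; rewrite xE yE ?eqxx ?orbT //.
Qed.

Lemma small_twin u v : ~~ large u -> ~~ large v -> v \in CN u -> CN v = CN u.
Proof.
move=> su sv vC; apply/esym/eqP; rewrite eqEcard !card_CN leqnn andbT.
apply/subsetP => y yC; rewrite in_CN; have [//|yv] := eqVneq y v.
by rewrite (small_block su) ?(negbTE sv) // eq_sym.
Qed.

(** * Partition of the vertices into copies of K_{k+1} - e *)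

Definition small_rep (x : T) : T :=
  if large x then odflt x [pick y in small_in (CN x)] else x.

Definition block (x : T) : {set T} := CN (small_rep x).

(** The default in [small_rep] is never reached, since N[x] contains k-1 > 0 small vertices. *)
Lemma small_repP x : ~~ large (small_rep x) /\ x \in CN (small_rep x).
Proof.
rewrite /small_rep; case: ifP => [lx|/negbT sx]; last by rewrite in_CN eqxx.
case: pickP => [y|H]; first by rewrite inE CN_sym => /andP[-> ->].
have := card_small_CN x; rewrite eq_card0 //; lia.
Qed.

(** The block does not depend on the chosen representative: a large y in N[u] is adjacent to all k-1
    small vertices of N[u], and it has only k-1 small neighbours. *)
Lemma block_small u y : ~~ large u -> y \in CN u -> block y = CN u.
Proof.
move=> su yC; have [sr yr] := small_repP y.
apply: small_twin => //.
have [ly|sy] := boolP (large y); last by rewrite /small_rep (negbTE sy).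
have E : small_in (CN u) = small_in (CN y).
  apply/eqP; rewrite eqEcard !card_small_CN leqnn andbT.
  apply/subsetP => z; rewrite !inE -in_CN => /andP[zC sz]; rewrite sz andbT.
  have [//|zy] := eqVneq z y.
  by rewrite /= e_sym (small_block su) // (negbTE sz).
have : small_rep y \in small_in (CN u) by rewrite E inE sr CN_sym yr.
by rewrite inE => /andP[].
Qed.

Lemma block_id x : x \in block x.
Proof. by have [] := small_repP x. Qed.

Lemma block_eq x y : y \in block x -> block y = block x.
Proof. by move=> yb; apply: block_small => //; have [] := small_repP x. Qed.

Lemma block_adj x y z : y \in block x -> z \in block x -> y != z ->
  e y z = ~~ (large y && large z).
Proof. by apply: small_block; have [] := small_repP x. Qed.

(** The block of a small vertex is its whole closed neighbourhood, so no edge leaves a block at a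
    small vertex. *)
Lemma adj_block x y : e x y -> block x != block y -> large x && large y.
Proof.
move=> exy; apply: contraR; rewrite negb_and => /orP[]s.
  by rewrite (block_small s (y := y)) ?(block_small s (y := x)) // in_CN ?eqxx ?exy ?orbT.
by rewrite (block_small s (y := y)) ?(block_small s (y := x)) // in_CN ?eqxx // e_sym exy orbT.
Qed.

(* [mate x] is the other large vertex of the copy of K_{k+1} - e containing x,
   and [out x] the large neighbour of x in another copy. *)
Definition mate (x : T) : T := if large x then other (large_in (block x)) x else x.
Definition out (x : T) : T := if large x then other (large_in (CN x)) x else x.

Lemma mateP x : large x -> mate x != x /\ large_in (block x) = [set x; mate x].
Proof.
by move=> lx; rewrite /mate lx; apply: otherP; rewrite ?card_large_CN // inE block_id.
Qed.

Lemma outP x : large x -> out x != x /\ large_in (CN x) = [set x; out x].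
Proof.
by move=> lx; rewrite /out lx; apply: otherP; rewrite ?card_large_CN // inE in_CN eqxx.
Qed.

Lemma mate_in x : large x -> large (mate x) /\ mate x \in block x.
Proof.
move=> lx; have [_ E] := mateP lx.
have : mate x \in large_in (block x) by rewrite E !inE eqxx orbT.
by rewrite inE => /andP[].
Qed.

Lemma out_in x : large x -> large (out x) /\ e x (out x).
Proof.
move=> lx; have [nx E] := outP lx.
have : out x \in large_in (CN x) by rewrite E !inE eqxx orbT.
by rewrite inE in_CN (negbTE nx) => /andP[].
Qed.

Lemma mate_uniq x y : large x -> large y -> y \in block x -> y != x -> y = mate x.
Proof.
move=> lx ly yb yx; have [_ E] := mateP lx.
have : y \in large_in (block x) by rewrite inE yb ly.
by rewrite E !inE (negbTE yx) => /eqP.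
Qed.

Lemma out_uniq x y : large x -> large y -> e x y -> y = out x.
Proof.
move=> lx ly exy; have [_ E] := outP lx.
have : y \in large_in (CN x) by rewrite inE in_CN exy ly orbT.
by rewrite E !inE => /orP[/eqP yx|/eqP //]; move: exy; rewrite yx e_irr.
Qed.

Lemma mateK : involutive mate.
Proof.
move=> x; have [lx|sx] := boolP (large x); last by rewrite /mate !(negbTE sx).
have [nx _] := mateP lx; have [lm mb] := mate_in lx.
by apply/esym/mate_uniq; rewrite // ?(block_eq mb) ?block_id // eq_sym.
Qed.

Lemma outK : involutive out.
Proof.
move=> x; have [lx|sx] := boolP (large x); last by rewrite /out !(negbTE sx).
by have [lm exo] := out_in lx; apply/esym/out_uniq; rewrite // e_sym.
Qed.

(** * Walking around the ring: cross the block, then step to the next one *)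

Definition next_end (x : T) : T := out (mate x).

Lemma next_end_inj : injective next_end.
Proof. exact: (inj_comp (inv_inj outK) (inv_inj mateK)). Qed.

Lemma large_next x : large x -> large (next_end x).
Proof. by move=> /mate_in[/out_in[]]. Qed.

Lemma large_iter x i : large x -> large (iter i next_end x).
Proof. by move=> lx; elim: i => //= i; apply: large_next. Qed.

(** The dihedral relation: conjugation by the involution [mate] inverts [next_end], a product of two
    involutions. *)
Lemma iter_mate i x : iter i next_end (mate (iter i next_end x)) = mate x.
Proof.
elim: i => // i IHi; rewrite iterSr [X in mate X]iterS.
by rewrite {2 3}/next_end mateK outK.
Qed.

Lemma iter_inj i : injective (iter i next_end).
Proof. by elim: i => [|i IHi] x y //= /next_end_inj/IHi. Qed.

(* [next_end] and [mate] generate a dihedral action whose reflections [mate] and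
   [out] have no fixed point on large vertices, so no reflection of [x] is a
   rotation of [x]. *)
Lemma iter_neq_mate i x : large x -> iter i next_end x != mate x.
Proof.
move=> lx; apply/eqP => E.
have := odd_double_half i; set t := i./2; set z := iter t next_end x => iE.
have lz : large z by apply: large_iter.
(* Cancelling t rotations on both sides leaves [next_end z = mate z] for odd i, a fixed point of
   [out], and [z = mate z] for even i. *)
move: E; rewrite -(iter_mate t x) -/z -iE -addnn.
case: (odd i).
  rewrite add1n -addnS iterD iterS -/z => /iter_inj E.
  by have [+ _] := outP (proj1 (mate_in lz)); rewrite -[out _]/(next_end z) E eqxx.
rewrite add0n iterD -/z => /iter_inj E.
by have [+ _] := mateP lz; rewrite -E eqxx.
Qed.

Lemma fconnect_neq_mate x y : large x -> fconnect next_end x y -> y != mate x.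
Proof. by move=> lx /iter_findex <-; apply: iter_neq_mate. Qed.

(** The blocks met by the orbit are closed under adjacency: an edge leaving the block of b does so
    at [mate b], towards [next_end b], or at b, towards the preceding block. *)
Lemma orbit_cover a x : large a ->
  exists b, [/\ fconnect next_end a b, large b & x \in block b].
Proof.
move=> la; move: x; apply: (connected_ind e_conn (x0 := a)); last first.
  by exists a; rewrite connect0 block_id.
move=> x y exy [b [ab lb xb]].
have [bxy|nb] := eqVneq (block x) (block y).
  by exists b; split=> //; rewrite -(block_eq xb) bxy block_id.
have /andP[lx ly] := adj_block exy nb.
have yE : y = out x by apply: out_uniq.
have [xE|xE] := eqVneq x b; last first.
  have {}xE : x = mate b by apply: mate_uniq.
  exists (next_end b); rewrite yE xE block_id large_next //; split=> //.
  by apply: connect_trans ab (fconnect1 _ _).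
have [lm mb] := mate_in ly.
exists (mate y); rewrite lm (block_eq mb) block_id; split=> //.
(* The step backwards stays in the orbit because an injective map on a finite type has cyclic
   orbits. *)
apply: connect_trans ab _; rewrite fconnect_sym; last exact: next_end_inj.
have -> : b = next_end (mate y) by rewrite /next_end mateK yE outK xE.
exact: fconnect1.
Qed.

(** The two ends occupy positions 0 and 1, the missing edge of each copy in [Gkl_rel]; the order of
    the small vertices is immaterial. *)
Definition block_seq (x : T) : seq T := x :: mate x :: enum (small_in (block x)).

Lemma size_block_seq x : size (block_seq x) = k.+1.
Proof. rewrite /= -cardE card_small_CN; lia. Qed.

Lemma mem_block_seq x : large x -> block_seq x =i block x.
Proof.
move=> lx y; have [_ E] := mateP lx.
have := in_set2 y x (mate x); rewrite -E in_large_in !in_cons mem_enum in_small_in.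
have [lm mb] := mate_in lx.
have [->|_] := eqVneq y x; first by rewrite block_id.
have [->|_] /= := eqVneq y (mate x); first by rewrite mb.
by case: (y \in block x); case: (large y).
Qed.

Lemma uniq_block_seq x : large x -> uniq (block_seq x).
Proof.
move=> lx; have [nx _] := mateP lx; have [lm mb] := mate_in lx.
by rewrite /= enum_uniq in_cons !mem_enum !in_small_in lx lm !andbF orbF eq_sym nx.
Qed.

Lemma large_nth x j : large x -> j < k.+1 -> large (nth x (block_seq x) j) = (j < 2).
Proof.
move=> lx jk; have [lm _] := mate_in lx.
case: j jk => [|[|j]] //= jk; apply/negbTE.
have : nth x (enum (small_in (block x))) j \in small_in (block x).
  rewrite -mem_enum mem_nth // -cardE card_small_CN; lia.
by rewrite inE => /andP[].
Qed.

Lemma nth_in_block x j : large x -> j < k.+1 -> nth x (block_seq x) j \in block x.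
Proof. by move=> lx jk; rewrite -mem_block_seq // mem_nth // size_block_seq. Qed.

Lemma extremal_iso : (k.+1 %| #|T|) /\ isomorphic e (@Gkl_rel k (#|T| %/ k.+1)).
Proof.
have /card_gt0P[u0 _] : 0 < #|T| by lia.
have [a] : exists a, a \in large_in (CN u0).
  by apply/card_gt0P; rewrite card_large_CN.
rewrite inE => /andP[_ la].
(* The number of copies is the length of the orbit of a; copy i is the block entered at [A i], and
   [g] reads off its vertices by position. *)
pose l := order next_end a.
pose A i := iter i next_end a.
have lA i : large (A i) by apply: large_iter.
pose g (p : 'I_l * 'I_k.+1) : T := nth (A p.1) (block_seq (A p.1)) p.2.
have gb p : g p \in block (A p.1) by apply: nth_in_block.
have con i j : fconnect next_end (A i) (A j).
  apply: (connect_trans (y := a)); last exact: fconnect_iter.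
  by rewrite fconnect_sym ?fconnect_iter //; apply: next_end_inj.
have nm i j : A i != mate (A j) by apply: fconnect_neq_mate.
have Ainj (i j : 'I_l) : A i = A j -> i = j.
  by move=> E; apply: val_inj; rewrite /= -(findex_iter (ltn_ord i)) -/(A i) E findex_iter.
(* A block has two ends, but the orbit contains only one of them, by [nm]. *)
have binj (i j : 'I_l) : block (A i) = block (A j) -> i = j.
  move=> E; have [/Ainj //|ij] := eqVneq (A i) (A j).
  by have := nm i j; rewrite -(mate_uniq (lA j) (lA i)) ?eqxx // -E block_id.
have ginj : injective g.
  move=> [i j] [i' j'] E.
  have ii : i = i'.
    by apply: binj; rewrite -(block_eq (gb (i, j))) E (block_eq (gb (i', j'))).
  rewrite -{}ii in E *; congr pair; apply/val_inj/eqP.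
  rewrite -(nth_uniq (A i) _ _ (uniq_block_seq (lA i))) ?size_block_seq ?ltn_ord //.
  by rewrite -[X in X == _]/(g (i, j)) E.
have gsurj x : x \in codom g.
  have [b [ab lb xb]] := orbit_cover x la.
  have iE : A (findex next_end a b) = b by rewrite /A iter_findex.
  have il : findex next_end a b < l by apply: findex_max.
  rewrite -mem_block_seq // in xb.
  have jk : index x (block_seq b) < k.+1 by rewrite -(size_block_seq b) index_mem.
  apply/codomP; exists (Ordinal il, Ordinal jk).
  by rewrite /g /= iE nth_index.
have cT : #|T| = l * k.+1.
  rewrite -(card_ord l) -(card_ord k.+1) -card_prod -(card_codom ginj).
  by apply: eq_card => x; rewrite gsurj.
have l2 : 1 < l by nia.
rewrite cT dvdn_mull // mulnK //; split=> //.
have gbij : bijective g.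
  by apply: inj_card_bij => //; rewrite cT card_prod !card_ord.
have Anext (i i' : 'I_l) : (A i' == next_end (A i)) = (val i' == (val i).+1 %% l).
  have [il|il] := ltnP (val i).+1 l.
    rewrite modn_small //; apply/eqP/eqP => [E|->] //.
    exact: (congr1 val (Ainj i' (Ordinal il) E)).
  have iE : (val i).+1 = l by apply/eqP; rewrite eqn_leq il andbT ltn_ord.
  rewrite iE modnn -[next_end _]/(A i.+1) -[i.+1]/((val i).+1) iE.
  rewrite [A l]iter_order; last exact: next_end_inj.
  have l0 : 0 < l by lia.
  by apply/eqP/eqP => [E|E]; [exact: (congr1 val (Ainj i' (Ordinal l0) E)) | rewrite /A E].
have eout x y : large x -> large y -> e x y = (y == out x).
  move=> lx ly; apply/idP/eqP => [|->]; first exact: out_uniq.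
  by have [] := out_in lx.
have gadj p q : e (g p) (g q) = Gkl_rel p q.
  case: p q => [i j] [i' j'] /=.
  have jk := ltn_ord j; have jk' := ltn_ord j'.
  have L1 : large (g (i, j)) = (j < 2) by apply: large_nth.
  have L2 : large (g (i', j')) = (j' < 2) by apply: large_nth.
  have [ii|ii] /= := eqVneq i i'.
    rewrite -{i'}ii in L2 *.
    (* As l >= 2, no index is its own cyclic successor, so within one copy the clauses for linking
       edges vanish. *)
    have -> : (val i == (val i).+1 %% l) = false.
      apply/negP => /eqP E; have il := ltn_ord i.
      have [h|h] := ltnP (val i).+1 l; first by move: E; rewrite modn_small //=; lia.
      have iE : (val i).+1 = l by apply/eqP; rewrite eqn_leq h andbT.
      by move: E; rewrite iE modnn; move: iE => /=; lia.
    rewrite !andbF !orbF.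
    have [->|jj] := eqVneq j j'; first by rewrite e_irr.
    have gg : g (i, j) != g (i, j').
      by apply: contra jj => /eqP/ginj [->].
    rewrite (block_adj (gb (i, j)) (gb (i, j')) gg) L1 L2.
    by case: j j' jj {gg L1 L2 jk jk'} => [[|[|j]] ?] [[|[|j']] ?].
  have nb : block (g (i, j)) != block (g (i', j')).
    by apply: contra ii => /eqP; rewrite !(block_eq (gb _)) => /binj /= ->.
  have [/andP[j2 j2']|nj] := boolP ((j < 2) && (j' < 2)); last first.
    have -> : e (g (i, j)) (g (i', j')) = false.
      by apply/negP => /adj_block/(_ nb); rewrite L1 L2 (negbTE nj).
    by case: j j' nj {nb L1 L2 jk jk'} => [[|[|j]] ?] [[|[|j']] ?].
  rewrite eout ?L1 ?L2 //.
  case: j j' j2 j2' {nb L1 L2 jk jk'} => [[|[|j]] ?] [[|[|j']] ?] //= _ _; rewrite /g /=.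
  (* Two entry ends are never adjacent, since otherwise [mate (A i')] would lie in the orbit of
     [A i']. *)
  - apply/negP => /eqP E.
    suff /(fconnect_neq_mate (lA i')) : fconnect next_end (A i') (mate (A i')).
      by rewrite eqxx.
    apply: connect_trans (con i' i) _.
    rewrite fconnect_sym; last exact: next_end_inj.
    have -> : A i = next_end (mate (A i')) by rewrite /next_end mateK E outK.
    exact: fconnect1.
  - rewrite -Anext -(can_eq outK) outK eq_sym //.
  - by rewrite orbF -Anext.
  - apply/negP => /eqP E; have := nm i.+1 i'.
    by rewrite -[A i.+1]/(next_end (A i)) E eqxx.
have [f gK fK] := gbij; exists f; split; first by exists g.
by move=> x y; rewrite -gadj !fK.
Qed.
End Extremal.

(** * Adjacency and defects in G(k,l) *)

Section GklNeighbours.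
Variables (k l : nat).
Hypothesis k_gt0 : 0 < k.
Implicit Types (i a : 'I_l) (j b : 'I_k.+1).

Lemma Gkl_relE i j a b : Gkl_rel (i, j) (a, b) =
  [|| (i == a) && (j != b) &&
        ~~ ((val j == 0) && (val b == 1) || (val j == 1) && (val b == 0)),
      (val j == 1) && (val b == 0) && (a == ordS i)
    | (val j == 0) && (val b == 1) && (i == ordS a)].
Proof. by []. Qed.

Lemma Gkl_nbr_first i j a b : val j = 0 -> Gkl_rel (i, j) (a, b) ->
  (a, b) = (ord_pred i, inord 1) \/ a = i /\ 1 < b.
Proof.
move=> j0; rewrite Gkl_relE j0 /= ?orbF.
case/orP => [/andP[/andP[/eqP -> b0] b1]|/andP[/eqP b1 /eqP ->]].
  by right; split=> //; move: b0 b1; rewrite -val_eqE j0 /=; lia.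
by left; rewrite ordSK; congr pair; apply: val_inj; rewrite /= inordK.
Qed.

Lemma Gkl_nbr_second i j a b : val j = 1 -> Gkl_rel (i, j) (a, b) ->
  (a, b) = (ordS i, ord0) \/ a = i /\ 1 < b.
Proof.
move=> j0; rewrite Gkl_relE j0 /= ?orbF.
case/orP => [/andP[/andP[/eqP -> b0] b1]|/andP[/eqP b1 /eqP ->]].
  by right; split=> //; move: b0 b1; rewrite -val_eqE j0 /=; lia.
by left; congr pair; apply: val_inj.
Qed.

Lemma Gkl_nbr_middle i j a b : 1 < j -> Gkl_rel (i, j) (a, b) -> a = i.
Proof.
rewrite Gkl_relE; case: j => [[|[|j]] jk] //= _.
by rewrite !orbF => /andP[/andP[/eqP ->]].
Qed.

Lemma Gkl_nonadj_block i b b' : (i, b) != (i, b') ->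
  Gkl_rel (i, b) (i, b') = false ->
  val b = 0 /\ val b' = 1 \/ val b = 1 /\ val b' = 0.
Proof.
rewrite xpair_eqE eqxx Gkl_relE /= eqxx => -> /=.
case: b b' => [[|[|b]] ?] [[|[|b']] ?] //= _; by [left | right].
Qed.

End GklNeighbours.

(** Each copy contributes at most 2 * 2(k-1) from its two ends and 2(k-1) from its k-1 middle
    vertices. The reverse estimate comes from [sum_defect_ge]. *)
Lemma Gkl_sum_defect (T : finType) (e : rel T) (k l : nat) :
  regular e k -> 3 <= k -> isomorphic e (@Gkl_rel k l) ->
  \sum_u defect e u <= 6 * k.-1 * l.
Proof.
move=> e_reg k3 [f [[g fK gK] fe]].
have k0 : 0 < k by lia.
have finj := can_inj fK.
pose F (j : 'I_k.+1) := if val j < 2 then 2 * k.-1 else 2.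
have le_defect u : defect e u <= F (f u).2.
  case fu : (f u) => [i j]; rewrite /F /=.
  (* Middle vertices of one copy are pairwise adjacent, so every missing edge in the neighbourhood
     of an end contains the neighbour p in another copy. *)
  have star p : Gkl_rel (i, j) p ->
      (forall a b, Gkl_rel (i, j) (a, b) -> (a, b) = p \/ a = i /\ 1 < b) ->
      defect e u <= 2 * k.-1.
    move=> ep H; apply: (defect_le_star e_reg (z := g p)).
      by rewrite -fe fu gK.
    move=> x y; rewrite -!fe fu /nonadj -fe -(inj_eq finj).
    case fx: (f x) => [a b]; case fy: (f y) => [a' b'].
    case/H=> [<- _ _|[-> b2]]; first by left; rewrite -fx fK.
    case/H=> [<- _|[-> b2']]; first by right; rewrite -fy fK.
    by case/andP=> n /negbTE /(Gkl_nonadj_block n); move: b2 b2' => /=; lia.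
  have [j0|j0] := eqVneq (val j) 0.
    rewrite [nat_of_ord j]j0 /=; apply: (star (ord_pred i, inord 1)).
      by rewrite Gkl_relE ord_predK j0 [val (inord 1)]inordK ?eqxx ?orbT //.
    by move=> a b; apply: Gkl_nbr_first.
  have [j1|j1] := eqVneq (val j) 1.
    rewrite [nat_of_ord j]j1 /=; apply: (star (ordS i, ord0)).
      by rewrite Gkl_relE j1 !eqxx orbT.
    by move=> a b; apply: Gkl_nbr_second.
  have j2 : 1 < j by move: j0 j1 => /=; lia.
  rewrite ltnNge j2 /=.
  apply: (defect_le2 (p := g (i, ord0)) (q := g (i, inord 1))) => x y.
  rewrite -!fe fu /nonadj -fe -(inj_eq finj).
  case fx: (f x) => [a b]; case fy: (f y) => [a' b'].
  move=> /(Gkl_nbr_middle j2) E /(Gkl_nbr_middle j2) E'.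
  rewrite {}E in fx *; rewrite {}E' in fy *.
  have g0 c : val c = 0 -> g (i, c) = g (i, ord0).
    by move=> c0; congr (g (_, _)); apply: val_inj.
  have g1 c : val c = 1 -> g (i, c) = g (i, inord 1).
    by move=> c1; congr (g (_, _)); apply: val_inj; rewrite /= inordK.
  case/andP=> n /negbTE /(Gkl_nonadj_block n); rewrite -(fK x) -(fK y) fx fy.
  by case=> -[? ?]; [left | right]; split; auto.
apply: (@leq_trans (\sum_u F (f u).2)); first exact: leq_sum.
rewrite (reindex g) /=; last by exists f => x _; rewrite ?fK ?gK.
under eq_bigr do rewrite gK.
rewrite -(pair_bigA _ (fun _ => F)) /= sum_nat_const card_ord.
rewrite mulnC leq_mul2r; apply/orP; right.
rewrite -(big_mkord predT (fun j => if j < 2 then 2 * k.-1 else 2)).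
rewrite (big_cat_nat (n := 2)) //= big_nat_recl // big_nat1 /=.
suff -> : \sum_(2 <= j < k.+1) (if j < 2 then 2 * k.-1 else 2) = \sum_(2 <= j < k.+1) 2.
  by rewrite sum_nat_const_nat; lia.
by apply: eq_big_nat => j /andP[j2 _]; rewrite ltnNge j2.
Qed.

(** * From defects to clustering coefficients *)

Local Open Scope ring_scope.

(** Counting ordered pairs doubles both the missing edges and the binomial coefficient, so each
    vertex has coefficient 1 - [defect] / (k(k-1)). *)
Lemma clusteringE (T : finType) (e : rel T) (k : nat) :
  symmetric e -> irreflexive e -> regular e k -> (2 <= k)%N -> (0 < #|T|)%N ->
  clustering e =
    1 - (\sum_u defect e u)%N%:R / (#|T| * (k * k.-1))%N%:R :> rat.
Proof.
move=> e_sym e_irr e_reg k2 T0.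
have T0' : (#|T|%:R : rat) != 0 by rewrite pnatr_eq0 -lt0n.
have k0 : ((k * k.-1)%N%:R : rat) != 0 by rewrite pnatr_eq0; lia.
have vE u : clust_vertex e u = 1 - (defect e u)%:R / (k * k.-1)%N%:R.
  rewrite /clust_vertex (card_nbhd e_reg u : deg e u = k) k2.
  have [d dE iE] := defect_half e_sym e_irr e_reg u.
  have E := induced_edges_defect e_sym e_irr e_reg u.
  have cE : (k * k.-1 = 2 * 'C(k, 2))%N by rewrite -E -iE dE; lia.
  have c0 : ('C(k, 2)%:R : rat) != 0.
    by move: k0; rewrite cE !pnatr_eq0; lia.
  have -> : (induced_edges e (nbhd e u))%:R = 'C(k, 2)%:R - d%:R :> rat.
    by rewrite -iE natrD addrK.
  by rewrite dE cE !natrM; field.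
rewrite /clustering (eq_bigr _ (fun u _ => vE u)).
rewrite sumrB -mulr_suml sumr_const cardT -cardE natr_sum natrM.
field.
by rewrite T0' !pnatr_eq0; lia.
Qed.

Theorem theorem1 (k n : nat) (T : finType) (e : rel T) :
  (3 <= k)%N -> (k + 2 <= n)%N ->
  symmetric e -> irreflexive e ->
  #|T| = n -> connected e -> regular e k ->
  clustering e <= 1 - 6%:R / (k * k.+1)%N%:R /\
  (clustering e = 1 - 6%:R / (k * k.+1)%N%:R <->
     ((k.+1 %| n)%N /\ isomorphic e (@Gkl_rel k (n %/ k.+1)%N))).
Proof.
move=> k3 kn e_sym e_irr Tn e_conn e_reg.
have kT : (k.+1 < #|T|)%N by rewrite Tn; lia.
have T0 : (0 < #|T|)%N by apply: leq_trans kT.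
have ge := sum_defect_ge e_sym e_irr e_reg e_conn kT.
rewrite (clusteringE e_sym e_irr e_reg (ltnW k3) T0).
set s := (\sum_u _)%N in ge *.
(* Over a common denominator, the gap to the bound is a positive multiple of the slack in
   [sum_defect_ge], which yields both the inequality and the equality criterion. *)
have E : 1 - s%:R / (#|T| * (k * k.-1))%N%:R =
    1 - 6%:R / (k * k.+1)%N%:R
    - ((k.+1 * s)%N%:R - (6 * k.-1 * #|T|)%N%:R)
      / (#|T| * (k * k.-1 * k.+1))%N%:R :> rat.
  rewrite !natrM; field.
  by rewrite nat1r !pnatr_eq0; lia.
have P0 : 0 < (#|T| * (k * k.-1 * k.+1))%N%:R :> rat by rewrite ltr0n !muln_gt0; lia.
rewrite {}E; split.
  by rewrite gerBl; apply: divr_ge0; [rewrite subr_ge0 ler_nat | apply: ltW].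
split=> [/eqP|[dvd iso]].
  rewrite -subr_eq0 addrC addKr oppr_eq0 mulf_eq0 invr_eq0 (gt_eqF P0) orbF.
  rewrite subr_eq0 eqr_nat => /eqP sE; rewrite -Tn.
  exact: (extremal_iso e_sym e_irr e_reg e_conn k3 kT sE).
have [l nE] : exists l, n = (l * k.+1)%N by exists (n %/ k.+1)%N; rewrite divnK.
have l2 : (1 < l)%N by nia.
rewrite nE mulnK // in iso.
have le := Gkl_sum_defect e_reg k3 iso.
(* With n = l(k+1), the bound s <= 6(k-1)l is exactly the inequality opposite to [ge]. *)
have -> : (k.+1 * s = 6 * k.-1 * #|T|)%N.
  by apply/eqP; rewrite eqn_leq ge andbT Tn nE /s; nia.
by rewrite subrr mul0r subr0.
Qed.
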